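(* Let $\mathbb{X}$ be a finite dimensional real Banach space and $\mathbb{Y}$ an arbitrary real Banach space. Let $T\in\mathbb{L}(\mathbb{X},\mathbb{Y})$ be such that $\|T\|=1$ and $M_T\cap \mathrm{Ext}(B_{\mathbb{X}})=\{\pm x_1,\pm x_2,\ldots,\pm x_r\}$, where $\{x_1,x_2,\ldots,x_r\}$ is a linearly independent subset of $\mathbb{X}$ (with $r$ elements). Let $k$ be a positive integer. Then $T$ is $k$-smooth if and only if there are positive integers $m_1,\ldots,m_r$ such that $Tx_i$ is $m_i$-smooth for each $1\le i\le r$ and $m_1+m_2+\cdots+m_r=k$.
   Context: All Banach spaces are real. For a Banach space $\mathbb{X}$, $B_{\mathbb{X}}=\{x:\|x\|\le 1\}$, $S_{\mathbb{X}}=\{x:\|x\|=1\}$, $\mathbb{X}^*$ is the dual space, and $\mathrm{Ext}(B_{\mathbb{X}})$ is the set of extreme points of $B_{\mathbb{X}}$. $\mathbb{L}(\mathbb{X},\mathbb{Y})$ is the space of bounded linear operators with the operator norm. For $x\in S_{\mathbb{X}}$, $J(x)=\{x^*\in S_{\mathbb{X}^*}: x^*(x)=1\}$. A vector $x\in S_{\mathbb{X}}$ is $k$-smooth if $\dim\operatorname{span}J(x)=k$. An operator $T\in \mathbb{L}(\mathbb{X},\mathbb{Y})$ with $\|T\|=1$ is $k$-smooth if it is $k$-smooth as an element of the unit sphere of the Banach space $\mathbb{L}(\mathbb{X},\mathbb{Y})$, i.e. $\dim\operatorname{span}J(T)=k$ with $J(T)=\{f\in S_{\mathbb{L}(\mathbb{X},\mathbb{Y})^*}: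 f(T)=1\}$. The norm attainment set of $T$ is $M_T=\{x\in S_{\mathbb{X}}:\|Tx\|=\|T\|\}$. *)

(* Defs.v *)
From HB Require Import structures.
From mathcomp Require Import all_boot all_order all_algebra.
From mathcomp Require Import boolp classical_sets functions reals.
From mathcomp Require Import topology normedtype.

Set Implicit Arguments.
Unset Strict Implicit.
Unset Printing Implicit Defensive.

Import Order.TTheory GRing.Theory Num.Theory.
Import numFieldNormedType.Exports.

Local Open Scope classical_set_scope.
Local Open Scope ring_scope.

Section BoundedOperators.
Context {R : realType} {V W : normedModType R}.

Definition bounded_op : {pred V -> W} :=
  fun f => `[< linear f /\ exists M : R, forall x, `|f x| <= M * `|x| >].

Lemma bounded_opP (f : V -> W) : reflect
  (linear f /\ exists M : R, forall x, `|f x| <= M * `|x|) (f \in bounded_op).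
Proof. exact: asboolP. Qed.

Lemma bounded_op_submod_closed : submod_closed bounded_op.
Proof.
split=> [|a f g /bounded_opP [fl [M fM]] /bounded_opP [gl [N gN]]].
  apply/bounded_opP; split=> [a x y|].
    by rewrite -[LHS]/(0 : W) -[RHS]/(a *: 0 + 0 : W) scaler0 addr0.
  by exists 0 => x; rewrite -[X in `|X|]/(0 : W) normr0 mul0r.
apply/bounded_opP; split=> [b x y|].
  rewrite -[LHS]/(a *: f (b *: x + y) + g (b *: x + y)).
  rewrite -[RHS]/(b *: (a *: f x + g x) + (a *: f y + g y)) fl gl !scalerDr !scalerA [a * b]mulrC.
  by rewrite addrACA.
exists (`|a| * M + N) => x; rewrite -[X in `|X|]/(a *: f x + g x) mulrDl.
rewrite (le_trans (ler_normD _ _)) // lerD // normrZ -mulrA.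
exact: ler_wpM2l.
Qed.

HB.instance Definition _ :=
  GRing.isSubmodClosed.Build R (V -> W) bounded_op bounded_op_submod_closed.

End BoundedOperators.

Record blop (R : realType) (V W : normedModType R) :=
  Blop { blop_fun :> V -> W ; _ : blop_fun \in bounded_op }.

HB.instance Definition _ (R : realType) (V W : normedModType R) :=
  [isSub of blop V W for @blop_fun R V W].
HB.instance Definition _ (R : realType) (V W : normedModType R) :=
  [Choice of blop V W by <:].
HB.instance Definition _ (R : realType) (V W : normedModType R) :=
  [SubChoice_isSubLmodule of blop V W by <:].

Definition unit_ball (R : realType) (V : normedModType R) : set V :=
  [set x | `|x| <= 1].
Definition unit_sphere (R : realType) (V : normedModType R) : set V :=
  [set x | `|x| = 1].
Arguments unit_ball {R} V.
Arguments unit_sphere {R} V.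

Section OperatorNorm.
Context {R : realType} {V W : normedModType R}.
Implicit Types T S : blop V W.

Definition op_norm T : R := sup [set `|T x| | x in unit_ball V].

Lemma blop_linear T : linear T.
Proof. by case: T => f /= /bounded_opP[]. Qed.

HB.instance Definition _ T :=
  GRing.isLinear.Build R V W _ (blop_fun T) (blop_linear T).

Lemma blopD T S x : (T + S) x = T x + S x.
Proof. by []. Qed.

Lemma blopZ a T x : (a *: T) x = a *: T x.
Proof. by []. Qed.

Lemma blop_has_sup T : has_sup [set `|T x| | x in unit_ball V].
Proof.
split; first by exists `|T 0|, 0 => //; rewrite /unit_ball /= normr0.
case: T => f /= /bounded_opP[_ [M fM]]; exists `|M| => _ [x x1 <-].
rewrite (le_trans (fM x)) // (le_trans (ler_wpM2r _ (ler_norm M))) //.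
exact: ler_piMr.
Qed.

Lemma op_norm_ub T x : `|x| <= 1 -> `|T x| <= op_norm T.
Proof. by move=> x1; apply: (sup_upper_bound (blop_has_sup T)); exists x. Qed.

Lemma op_norm_lub T M : (forall x, `|x| <= 1 -> `|T x| <= M) -> op_norm T <= M.
Proof.
move=> TM; apply: ge_sup; first by case: (blop_has_sup T).
by move=> _ [x x1 <-]; exact: TM.
Qed.

Lemma op_norm_ge0 T : 0 <= op_norm T.
Proof. by apply: le_trans (op_norm_ub T (x := 0) _); rewrite ?normr0. Qed.

Lemma ler_op_normD T S : op_norm (T + S) <= op_norm T + op_norm S.
Proof.
apply: op_norm_lub => x x1; rewrite blopD (le_trans (ler_normD _ _)) //.
by rewrite lerD // op_norm_ub.
Qed.

Lemma op_normZ a T : op_norm (a *: T) = `|a| * op_norm T.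
Proof.
have le b S : op_norm (b *: S) <= `|b| * op_norm S.
  apply: op_norm_lub => x x1; rewrite blopZ normrZ.
  by rewrite ler_wpM2l // op_norm_ub.
apply/le_anti; rewrite le /=.
have [->|a0] := eqVneq a 0; first by rewrite normr0 mul0r op_norm_ge0.
rewrite -ler_pdivlMl ?normr_gt0 // -normfV.
by rewrite -[in leLHS](scalerK a0 T); exact: le.
Qed.

Lemma op_norm0_eq0 T : op_norm T = 0 -> T = 0.
Proof.
move=> T0; apply: val_inj; apply/funext => x; rewrite /= -[RHS]/(0 : W).
have [->|x0] := eqVneq x 0; first by rewrite linear0.
have nx0 : `|x| != 0 by rewrite normr_eq0.
have : `|T (`|x|^-1 *: x)| <= op_norm T.
  by apply: op_norm_ub; rewrite normrZ normfV normr_id mulVf.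
rewrite T0 normr_le0 linearZ /= scaler_eq0 invr_eq0 (negbTE nx0) /=.
by move/eqP.
Qed.

HB.instance Definition _ := Lmodule_isNormed.Build R (blop V W)
  ler_op_normD op_normZ op_norm0_eq0.

Lemma blop_normE T : `|T| = sup [set `|T x| | x in unit_ball V].
Proof. by []. Qed.

End OperatorNorm.

Definition dual (R : realType) (V : normedModType R) : normedModType R :=
  blop V R^o.

Section LinearAlgebra.
Context {R : realType} {V : lmodType R}.

Definition lin_indep n (e : 'I_n -> V) :=
  forall c : 'I_n -> R, \sum_i c i *: e i = 0 -> forall i, c i = 0.

Definition lin_span (A : set V) : set V :=
  [set v | exists n (c : 'I_n -> R) (a : 'I_n -> V),
     (forall i, A (a i)) /\ v = \sum_i c i *: a i].

(* The subspace S has finite dimension n; an infinite-dimensional S has no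
   such n. *)
Definition has_dim (S : set V) (n : nat) :=
  exists e : 'I_n -> V, lin_indep e /\ lin_span (range e) = S.

End LinearAlgebra.

Definition finite_dimensional (R : realType) (V : lmodType R) :=
  exists n, has_dim [set: V] n.

Definition extreme_points (R : realType) (V : lmodType R) (A : set V) : set V :=
  [set x | A x /\ forall y z (t : R), A y -> A z -> 0 < t -> t < 1 ->
     x = t *: y + (1 - t) *: z -> y = x /\ z = x].

Section Smoothness.
Context {R : realType} {V : normedModType R}.

Definition support_functionals (x : V) : set (dual V) :=
  [set f | unit_sphere (dual V) f /\ f x = 1].

Definition k_smooth (k : nat) (x : V) :=
  unit_sphere V x /\ has_dim (lin_span (support_functionals x)) k.

End Smoothness.

Definition norm_attainment (R : realType) (V W : normedModType R)
    (T : blop V W) : set V :=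
  [set x | unit_sphere V x /\ `|T x| = `|T|].

(* Main.v *)
(* A functional [f] in J(T) satisfies [f S <= |S (x i)|] for some [i]: comparing
   [1 + t f(S)] with [|T + t S|] as [t] tends to 0 gives a point of M_T with
   this property, and the maximisers of [|S v|] over M_T form a face of the
   ball, hence contain an extreme point. So [f] only depends on the values
   [S (x i)], i.e. f(S) = g_1(S x_1) + ... + g_r(S x_r), and testing on
   perturbations of [T] by rank-one operators shows that each [g_i] is a
   nonnegative multiple of a functional in J(T x_i). Therefore span J(T) is the
   direct sum of copies of the spans of the J(T x_i). The positivity of the
   [m i] is the Hahn-Banach theorem. *)
Require Import Defs.
From HB Require Import structures.
From mathcomp Require Import all_boot all_order all_algebra.
From mathcomp Require Import boolp classical_sets functions reals.
From mathcomp Require Import topology normedtype.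
From mathcomp Require Import derive ring lra.

Set Implicit Arguments.
Unset Strict Implicit.
Unset Printing Implicit Defensive.

Import Order.TTheory GRing.Theory Num.Theory.
Import numFieldNormedType.Exports.

Local Open Scope classical_set_scope.
Local Open Scope ring_scope.

(** * Spans and dimension *)

Section LinearSpan.
Context {R : realType} {V : lmodType R}.
Implicit Types (A S : set V) (u v : V).

Lemma lin_span_fin A (I : finType) (c : I -> R) (a : I -> V) :
  (forall i, A (a i)) -> lin_span A (\sum_i c i *: a i).
Proof.
move=> Aa; exists #|I|, (fun j => c (enum_val j)), (fun j => a (enum_val j)).
by split=> // ; rewrite (reindex _ (onW_bij _ (@enum_val_bij I))).
Qed.

Lemma sub_lin_span A : A `<=` lin_span A.
Proof.
by move=> v Av; exists 1%N, (fun=> 1), (fun=> v); rewrite big_ord1 scale1r.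
Qed.

Lemma lin_spanD A u v : lin_span A u -> lin_span A v -> lin_span A (u + v).
Proof.
move=> [n [c [a [Aa ->]]]] [m [d [b [Ab ->]]]].
pose h (p : 'I_n + 'I_m) := if p is inl i then c i else
  if p is inr j then d j else 0.
pose g (p : 'I_n + 'I_m) := match p with inl i => a i | inr j => b j end.
have -> : \sum_i c i *: a i + \sum_i d i *: b i = \sum_p h p *: g p.
  by rewrite big_sumType.
by apply: lin_span_fin => -[].
Qed.

Lemma lin_spanZ A (t : R) u : lin_span A u -> lin_span A (t *: u).
Proof.
move=> [n [c [a [Aa ->]]]]; rewrite scaler_sumr.
by under eq_bigr do rewrite scalerA; exact: lin_span_fin.
Qed.

Lemma lin_span0 A : lin_span A 0.
Proof. by exists 0%N, (fun=> 0), (fun=> 0); split=> [[]//|]; rewrite big_ord0. Qed.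

Lemma lin_span_sum A (I : finType) (v : I -> V) :
  (forall i, lin_span A (v i)) -> lin_span A (\sum_i v i).
Proof.
move=> Av; apply: (big_ind (lin_span A)) => //; [exact: lin_span0|exact: lin_spanD].
Qed.

Lemma lin_span_min A B : A `<=` lin_span B -> lin_span A `<=` lin_span B.
Proof.
move=> AB _ [n [c [a [Aa ->]]]]; apply: lin_span_sum => i.
exact/lin_spanZ/AB.
Qed.

Lemma lin_span_rangeP n (e : 'I_n -> V) v :
  lin_span (range e) v <-> exists c : 'I_n -> R, v = \sum_i c i *: e i.
Proof.
split=> [[m [c [a [ae ->]]]]|[c ->]]; last by apply: lin_span_fin => i; exists i.
have /choice[s sE] j : exists i, e i = a j by have [i _ <-] := ae j; exists i.
(* A generator may occur several times in the combination, so its coefficients are collected over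
   the fibre of [s]. *)
exists (fun i => \sum_(j | s j == i) c j).
rewrite (partition_big s predT) //=; apply: eq_bigr => i _.
by rewrite scaler_suml; apply: eq_bigr => j /eqP <-; rewrite sE.
Qed.

(** A row vector in the left kernel of the coefficient matrix is the coefficient vector of a
    vanishing combination of the [u i]. *)
Lemma row_free_lin_indep p q (u : 'I_p -> V) (w : 'I_q -> V) M :
  lin_indep u -> (forall i, u i = \sum_j M i j *: w j) ->
  row_free (\matrix_(i, j) M i j).
Proof.
move=> ui ME; set A := matrix_of_fun _ _.
rewrite -kermx_eq0; apply/eqP/row_matrixP => k; rewrite row0.
set c := row k _; have cA : c *m A = 0 by rewrite /c -row_mul mulmx_ker row0.
apply/rowP => i; rewrite [RHS]mxE; apply: (ui (c 0)).
under eq_bigr do rewrite ME scaler_sumr.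
rewrite exchange_big /= big1 // => j _.
under eq_bigr do rewrite scalerA.
have /rowP/(_ j) := cA; rewrite -scaler_suml !mxE => cAj.
have -> : \sum_(a < p) c 0 a * M a j = 0; last exact: scale0r.
by rewrite -[RHS]cAj; apply: eq_bigr => a _; rewrite [A _ _]mxE.
Qed.

Lemma lin_indep_leq p q (u : 'I_p -> V) (w : 'I_q -> V) :
  lin_indep u -> (forall i, lin_span (range w) (u i)) -> (p <= q)%N.
Proof.
move=> ui uw; have /choice[M ME] i : exists c, u i = \sum_j c j *: w j.
  exact/lin_span_rangeP.
have := row_free_lin_indep ui ME; rewrite -row_leq_rank.
by move=> /leq_trans; apply; exact: rank_leq_col.
Qed.

Lemma has_dim_uniq S n m : has_dim S n -> has_dim S m -> n = m.
Proof.
move=> [e [ei eS]] [f [fi fS]]; apply/eqP; rewrite eqn_leq; apply/andP; split.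
  apply: (lin_indep_leq (w := f) ei) => i.
  by rewrite fS -eS; apply: sub_lin_span; exists i.
apply: (lin_indep_leq (w := e) fi) => i.
by rewrite eS -fS; apply: sub_lin_span; exists i.
Qed.

Lemma has_dim_fin (I : finType) (e : I -> V) S :
  (forall c : I -> R, \sum_i c i *: e i = 0 -> forall i, c i = 0) ->
  S = [set v | exists c : I -> R, v = \sum_i c i *: e i] -> has_dim S #|I|.
Proof.
move=> ei ->; exists (e \o enum_val); split=> [c c0 i|].
  rewrite -[i]enum_valK; apply: (ei (c \o enum_rank)).
  rewrite -[RHS]c0 (reindex _ (onW_bij _ (@enum_val_bij I))).
  by apply: eq_bigr => j _ /=; rewrite enum_valK.
apply/seteqP; split=> v.
  move=> /lin_span_rangeP[c ->]; exists (c \o enum_rank).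
  rewrite [RHS](reindex _ (onW_bij _ (@enum_val_bij I))).
  by apply: eq_bigr => i _ /=; rewrite enum_valK.
move=> [c ->]; apply/lin_span_rangeP; exists (c \o enum_val).
by rewrite (reindex _ (onW_bij _ (@enum_val_bij I))).
Qed.

(** An independent family of maximal length in the span generates it, since any vector outside its
    span could be adjoined. *)
Lemma has_dim_bounded A k :
  (forall n (e : 'I_n -> V), lin_indep e -> range e `<=` lin_span A -> (n <= k)%N) ->
  exists m, has_dim (lin_span A) m.
Proof.
move=> bnd.
pose P n := `[< exists e : 'I_n -> V, lin_indep e /\ range e `<=` lin_span A >].
have P0 : exists n, P n.
  exists 0%N; apply/asboolP; exists (fun=> 0).
  by split=> [c _ i|v [i]]; case: i.
have Pk n : P n -> (n <= k)%N by move=> /asboolP[e [ei /(bnd _ _ ei)]].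
case: (ex_maxnP P0 Pk) => m /asboolP[e [ei eA]] mmax; exists m, e; split=> //.
apply/seteqP; split=> [|v Av]; first exact: lin_span_min.
apply: contrapT => nv; suff /mmax : P m.+1 by rewrite ltnn.
(* The longer family has [v] at index 0, followed by [e]. A nonzero coefficient of [v] in a
   vanishing combination could be divided out and would put [v] in the span of [e]. *)
apply/asboolP; exists (fun i => if unlift ord0 i is Some j then e j else v).
split=> [c|_ [i _ <-]]; last by case: unliftP => [j|] _ //; apply: eA; exists j.
rewrite big_ord_recl unlift_none.
under eq_bigr do rewrite liftK.
move=> c0; have c00 : c ord0 = 0.
  apply/eqP/contraT => cn0; case: nv; apply/lin_span_rangeP.
  exists (fun j => - (c ord0)^-1 * c (lift ord0 j)).
  apply: (scalerI cn0); move/eqP: c0; rewrite addr_eq0 => /eqP ->.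
  rewrite scaler_sumr -sumrN; apply: eq_bigr => j _.
  by rewrite scalerA mulrA mulrN mulfV // mulN1r scaleNr.
move: c0; rewrite c00 scale0r add0r => /ei cj i.
by case: (unliftP ord0 i) => [j ->|-> //]; exact: cj.
Qed.

End LinearSpan.

(** An injective linear map preserves independence, so [k] bounds the length of every independent
    family in the span of [A]. *)
Lemma has_dim_preim (R : realType) (U V : lmodType R) (h : {linear U -> V})
    (A : set U) (S : set V) k :
  injective h -> (forall u, lin_span A u -> S (h u)) -> has_dim S k ->
  exists m, has_dim (lin_span A) m.
Proof.
move=> hI hA [b [_ bS]]; apply: (@has_dim_bounded _ _ _ k) => n e ei eA.
apply: (@lin_indep_leq _ _ _ _ (h \o e) b) => [c c0|i].
  apply: ei; apply: hI; rewrite linear0 -[RHS]c0 linear_sum.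
  by apply: eq_bigr => i _; rewrite linearZ.
by rewrite bS; apply/hA/eA; exists i.
Qed.

(** The images under [h i] of a basis of [S i], indexed by the pairs in [J], together form a basis
    of the sum. *)
Lemma has_dim_direct_sum (R : realType) (U V : lmodType R) r
    (h : 'I_r -> {linear U -> V}) (S : 'I_r -> set U) (m : 'I_r -> nat) :
  (forall g : 'I_r -> U, \sum_i h i (g i) = 0 -> forall i, g i = 0) ->
  (forall i, has_dim (S i) (m i)) ->
  has_dim [set v | exists g : 'I_r -> U,
    (forall i, S i (g i)) /\ v = \sum_i h i (g i)] (\sum_i m i).
Proof.
move=> hI Sm; pose J := {i : 'I_r & 'I_(m i)}.
have -> : (\sum_i m i)%N = #|{: J}|.
  by rewrite card_tagged sumnE big_map big_enum; apply: eq_bigr => i _; rewrite card_ord.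
(* The index type of a basis depends on [i]; extending each basis by 0 to all of [nat] gives one
   common type in which to choose. *)
have /choice[e eP] i : exists e : nat -> U, exists f : 'I_(m i) -> U,
    [/\ forall j, e (nat_of_ord j) = f j, lin_indep f & lin_span (range f) = S i].
  have [f [fi fS]] := Sm i.
  exists (fun n => if insub n is Some j then f j else 0), f; split=> // j.
  by rewrite valK.
have sumJ (c : J -> R) : \sum_p c p *: h (tag p) (e (tag p) (tagged p)) =
    \sum_i h i (\sum_(j < m i) c (Tagged (fun i => 'I_(m i)) j) *: e i j).
  transitivity (\sum_i \sum_(j < m i) c (Tagged (fun i => 'I_(m i)) j) *: h i (e i j)).
    by rewrite sig_big_dep; apply: eq_big => -[].
  apply: eq_bigr => i _; rewrite linear_sum.
  by apply: eq_bigr => j _; rewrite linearZ.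
apply: (@has_dim_fin _ _ _ (fun p : J => h (tag p) (e (tag p) (tagged p)))).
  move=> c; rewrite sumJ => /hI c0 [i j]; have [f [ef fi _]] := eP i.
  apply: (fi (fun j => c (Tagged (fun i => 'I_(m i)) j))).
  by rewrite -[RHS](c0 i); apply: eq_bigr => l _; rewrite ef.
apply/seteqP; split=> v.
  move=> [g [gS ->]].
  have /choice[c cE] i : exists c : nat -> R, g i = \sum_(j < m i) c j *: e i j.
    have [f [ef fi fS]] := eP i; have := gS i; rewrite -fS.
    move=> /lin_span_rangeP[c ->].
    exists (fun n => if insub n is Some j then c j else 0).
    by apply: eq_bigr => j _; rewrite valK ef.
  exists (fun p : J => c (tag p) (tagged p)); rewrite sumJ.
  by apply: eq_bigr => i _; rewrite cE.
move=> [c ->]; rewrite sumJ.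
exists (fun i => \sum_(j < m i) c (Tagged (fun i => 'I_(m i)) j) *: e i j); split=> // i.
have [f [ef fi <-]] := eP i; apply/lin_span_rangeP.
exists (fun j => c (Tagged (fun i => 'I_(m i)) j)).
by apply: eq_bigr => j _; rewrite ef.
Qed.

(** * Hahn-Banach *)

Section OperatorBounds.
Context {R : realType} {V W : normedModType R}.
Implicit Types T : blop V W.

Lemma blop_le T v : `|T v| <= `|T| * `|v|.
Proof.
have [->|v0] := eqVneq v 0; first by rewrite linear0 !normr0 mulr0.
have nv0 : 0 < `|v| by rewrite normr_gt0.
rewrite -ler_pdivrMr // mulrC -[X in X * _]gtr0_norm ?invr_gt0 // -normrZ -linearZ.
by apply: op_norm_ub; rewrite normrZ normfV normr_id mulVf ?gt_eqF.
Qed.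

Lemma blop_norm_le T M : 0 <= M ->
  (forall v, `|T v| <= M * `|v|) -> `|T| <= M.
Proof.
move=> M0 TM; apply: op_norm_lub => v v1.
by rewrite (le_trans (TM v)) // ler_piMr.
Qed.

End OperatorBounds.

Section HahnBanach.
Context {R : realType} {V : normedModType R}.
Implicit Types (p q : V -> R) (u v : V).

(** Homogeneity is asked only as an inequality, which passes easily to infima; applying it to [t^-1]
    as well gives equality. *)
Definition sublinear p :=
  (forall u v, p (u + v) <= p u + p v) /\
  (forall t v, 0 < t -> p (t *: v) <= t * p v).

Lemma sublinear0 p : sublinear p -> p 0 = 0.
Proof.
move=> [pD pZ]; have := pD 0 0; have := pZ 2^-1 0.
by rewrite scaler0 addr0 invr_gt0 ltr0n => /(_ isT) *; lra.
Qed.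

Lemma sublinear_opp p v : sublinear p -> - p (- v) <= p v.
Proof.
move=> ps; have [pD _] := ps; have := pD v (- v).
by rewrite subrr sublinear0 // => ?; lra.
Qed.

Lemma sublinearZ p t v : sublinear p -> 0 < t -> p (t *: v) = t * p v.
Proof.
move=> [_ pZ] t0; apply/le_anti; rewrite pZ //=.
have := pZ t^-1 (t *: v); rewrite scalerK ?gt_eqF // invr_gt0 => /(_ t0).
by rewrite ler_pdivlMl.
Qed.

(** The bound [- p (- v)] keeps the pointwise infimum finite, and the other two conditions carry
    over to it as subadditivity and homogeneity. It serves both the shift below and the lower bounds
    of chains in Zorn's lemma. *)
Lemma sublinear_inf p (I : Type) (D : set I) (f : I -> V -> R) :
  D !=set0 -> (forall i v, D i -> - p (- v) <= f i v) ->
  (forall i j u v, D i -> D j -> exists2 k, D k & f k (u + v) <= f i u + f j v) ->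
  (forall i t v, D i -> 0 < t -> exists2 j, D j & f j (t *: v) <= t * f i v) ->
  exists2 q, sublinear q & forall i v, D i -> q v <= f i v.
Proof.
move=> [i0 Di0] lbf fD fZ.
pose q v := inf [set f i v | i in D].
have qle i v : D i -> q v <= f i v.
  move=> Di; apply: ge_inf; last by exists i.
  by exists (- p (- v)) => _ [j Dj <-]; exact: lbf.
have qge v c : (forall i, D i -> c <= f i v) -> c <= q v.
  by move=> cf; apply: lb_le_inf; [exists (f i0 v), i0|move=> _ [i Di <-]; exact: cf].
exists q => //; split=> [u v|t v t0].
  rewrite -lerBlDr; apply: (qge) => i Di.
  rewrite lerBlDr -lerBlDl; apply: (qge) => j Dj.
  have [k Dk fk] := fD i j u v Di Dj; rewrite lerBlDl.
  exact: le_trans (qle _ _ Dk) fk.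
rewrite -ler_pdivrMl //; apply: (qge) => i Di; rewrite ler_pdivrMl //.
by have [j Dj fj] := fZ i t v Di t0; rewrite (le_trans (qle _ _ Dj)).
Qed.

(** Take for [q u] the infimum of [p (u + t *: v) - t * p v] over [t > 0]. The value at [t = 1]
    gives the second bound, and subadditivity then gives the first. At [u = - v] the second bound
    reads [q (- v) <= - p v], so a linear functional below [q] is at least [p v] at [v]. *)
Lemma sublinear_shift p v : sublinear p ->
  exists2 q, sublinear q & forall u, q u <= p u /\ q u <= p (u + v) - p v.
Proof.
move=> ps; have [pD pZ] := ps.
have [||||q qs qle] := @sublinear_inf p R [set t | 0 < t]
    (fun t u => p (u + t *: v) - t * p v).
- by exists 1 => /=.
- move=> t u /= t0; have := pD (u + t *: v) (- u).
  by rewrite addrAC subrr add0r; have := sublinearZ v ps t0 => *; lra.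
- move=> s t u w /= s0 t0; exists (s + t); first exact: addr_gt0.
  have := pD (u + s *: v) (w + t *: v).
  by rewrite addrACA -scalerDl => *; lra.
- move=> s t u /= s0 t0; exists (t * s); first exact: mulr_gt0.
  have := pZ t (u + s *: v) t0.
  by rewrite scalerDr scalerA => *; lra.
exists q => // u; split; have := qle 1 u ltr01; rewrite scale1r mul1r //.
by have := pD u v => *; lra.
Qed.

(* Zorn: a minimal sublinear functional is linear, as minimality and
   [sublinear_shift] force [p u <= p (u + v) - p v]. *)
Lemma sublinear_dominates_linear p : sublinear p ->
  exists2 f : V -> R, linear (f : V -> R^o) & forall v, f v <= p v.
Proof.
move=> ps; pose P q := sublinear q /\ forall v, q v <= p v; pose T := sig P.
have Pp : P p by split.
(* The order is reversed, so that a maximal element for Zorn's lemma is a minimal functional. *)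
pose below (q1 q2 : T) := `[< forall v, sval q2 v <= sval q1 v >].
have [||A Atot|[q [qs qp]] qmin] :=
    @ZL_preorder T (exist P p Pp) below.
- by move=> q; apply/asboolP.
- move=> q1 q2 q3 /asboolP le12 /asboolP le23; apply/asboolP => v.
  exact: le_trans (le23 v) (le12 v).
- have [[q0 Aq0]|An] := pselect (A !=set0); last first.
    exists (exist P p Pp) => q Aq.
    by exfalso; apply: An; exists q.
  have [||||q qs qle] := @sublinear_inf p T A (fun q : T => sval q).
  + by exists q0.
  + move=> [q [qs qp]] v /= _; apply: le_trans (sublinear_opp v qs).
    by rewrite lerN2.
  (* Of two members of the chain, the smaller one witnesses the subadditivity condition. *)
  + move=> q1 q2 u v A1 A2; have [/asboolP le12|/asboolP le21] := Atot _ _ A1 A2.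
      exists q2 => //; have [[+ _] _] := svalP q2; move=> /(_ u v) => h.
      by rewrite (le_trans h) // lerD2r.
    exists q1 => //; have [[+ _] _] := svalP q1; move=> /(_ u v) => h.
    by rewrite (le_trans h) // lerD2l.
  + move=> q1 t v A1 t0; exists q1 => //; have [[_ +] _] := svalP q1; exact.
  have qp v : q v <= p v.
    by apply: le_trans (qle _ _ Aq0) _; have [_ +] := svalP q0; exact.
  by exists (exist P q (conj qs qp)) => q1 Aq1; apply/asboolP => v; exact: qle.
have [qD qZ] := qs.
have qadd u v : q (u + v) = q u + q v.
  apply/le_anti; rewrite qD /=.
  have [q1 q1s q1le] := sublinear_shift v qs.
  have q1p w : q1 w <= p w by apply: le_trans (qp w); have [] := q1le w.
  have /asboolP /(_ u) /= : below (exist P q1 (conj q1s q1p)) (exist P q (conj qs qp)).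
    by apply: qmin; apply/asboolP => w /=; have [] := q1le w.
  by have [_] := q1le u => *; lra.
have qN v : q (- v) = - q v.
  by apply/eqP; rewrite -subr_eq0 opprK -qadd addNr sublinear0.
exists q => // t u v; rewrite qadd; congr (_ + _).
have [t0|t0|<-] := ltgtP 0 t; [exact: sublinearZ| |].
  rewrite -[in LHS](opprK t) scaleNr qN sublinearZ ?oppr_gt0 //.
  by rewrite mulNr opprK.
by rewrite !scale0r sublinear0.
Qed.

(** Shift the norm along [v] and take a linear [f] below the result: [f] is dominated by the norm,
    and [f (- v) <= - 1] forces [f v = 1]. *)
Lemma support_functionals_nonempty v : `|v| = 1 ->
  support_functionals v !=set0.
Proof.
move=> v1; have ns : sublinear (fun u : V => `|u|).
  split=> [u w|t u t0]; first exact: ler_normD.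
  by rewrite normrZ gtr0_norm.
have [p ps ple] := sublinear_shift v ns.
have [f fl fp] := sublinear_dominates_linear ps.
have f0 : f 0 = 0 by have := fl (-1) 0 0; rewrite !scaleN1r !addNr.
have fN u : f (- u) = - f u.
  by have := fl (-1) u 0; rewrite !scaleN1r !addr0 f0 addr0.
have fle u : f u <= `|u| by apply: le_trans (fp u) _; have [] := ple u.
have fb u : `|f u| <= `|u| by rewrite ler_norml lerNl -fN -normrN !fle normrN fle.
have F_bounded : f \in @bounded_op R V R^o.
  by apply/bounded_opP; split=> //; exists 1 => u; rewrite mul1r.
pose F : dual V := Blop F_bounded.
have Fv : F v = 1.
  apply/le_anti; rewrite -{1}v1 fle /=.
  have [_] := ple (- v); rewrite addNr normr0 v1 sub0r => /(le_trans (fp _)).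
  by rewrite fN lerN2.
exists F; split=> //; rewrite /unit_sphere /=; apply/le_anti/andP; split.
  by apply: blop_norm_le => // u; rewrite mul1r; exact: fb.
by have := blop_le F v; rewrite Fv normr1 v1 mulr1.
Qed.

End HahnBanach.

(** * Finite-dimensional normed spaces *)

Lemma lipschitz_continuous (R : realType) (V W : normedModType R) (f : V -> W) M :
  (forall u v, `|f u - f v| <= M * `|u - v|) -> continuous f.
Proof.
(* The sign of [M] is unknown; [|M| + 1] is a positive Lipschitz constant, by which one can
   divide. *)
have M1 : 0 < `|M| + 1 by rewrite ltr_wpDl.
move=> fM u; apply/cvgrPdist_le => e e0; near=> v.
apply: le_trans (_ : (`|M| + 1) * `|u - v| <= _).
  by rewrite (le_trans (fM u v)) // ler_wpM2r // (le_trans (ler_norm M)) // lerDl.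
rewrite -ler_pdivlMl //; near: v; apply: cvgr_dist_le; first exact: cvg_id.
by rewrite mulr_gt0 ?invr_gt0.
Unshelve. all: by end_near. Qed.

Lemma coord_norm_le (R : realType) n (c : 'rV[R]_n) i : `|c 0 i| <= `|c|.
Proof.
rewrite [leRHS](_ : _ = mx_norm c) // mx_normrE.
by apply/bigmax_geP; right => /=; exists (0, i).
Qed.

Lemma lin_comb_continuous (R : realType) (V : normedModType R) n (e : 'I_n -> V) :
  continuous (fun c : 'rV[R]_n => \sum_i c 0 i *: e i).
Proof.
apply: (@lipschitz_continuous _ _ _ _ (\sum_i `|e i|)) => c d.
rewrite -sumrB (le_trans (ler_norm_sum _ _ _)) // mulr_suml.
apply: ler_sum => i _; rewrite -scalerBl normrZ mulrC ler_wpM2l //.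
by have := coord_norm_le (c - d) i; rewrite !mxE.
Qed.

(** On the compact unit sphere of the coordinate space the norm of the combination has a positive
    minimum, by independence of the basis. The inverse of that minimum is the bound [M]. *)
Lemma finite_dim_coord (R : realType) (V : normedModType R) :
  finite_dimensional V ->
  exists n (e : 'I_n -> V) (k : V -> 'rV[R]_n) (M : R),
    [/\ 0 <= M, linear k, forall v, v = \sum_i k v 0 i *: e i &
      forall v, `|k v| <= M * `|v|].
Proof.
move=> [n [e [ei eT]]].
have /choice[k kE] v : exists c : 'rV[R]_n, v = \sum_i c 0 i *: e i.
  have : lin_span (range e) v by rewrite eT.
  move=> /lin_span_rangeP[c ->]; exists (\row_i c i).
  by apply: eq_bigr => i _; rewrite mxE.
pose comb (c : 'rV[R]_n) := \sum_i c 0 i *: e i.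
have combB c d : comb c - comb d = comb (c - d).
  rewrite /comb -sumrB; apply: eq_bigr => i _.
  by rewrite !mxE scalerBl.
have combZ t c : comb (t *: c) = t *: comb c.
  rewrite /comb scaler_sumr; apply: eq_bigr => i _.
  by rewrite !mxE scalerA.
have comb0 c : comb c = 0 -> c = 0.
  by move=> c0; apply/rowP => i; rewrite [RHS]mxE; exact: (ei (c 0)).
have combD c d : comb (c + d) = comb c + comb d.
  by rewrite -[d in LHS]opprK -combB -[- d]scaleN1r combZ scaleN1r opprK.
have combI c d : comb c = comb d -> c = d.
  by move=> cd; apply/eqP; rewrite -subr_eq0; apply/eqP/comb0; rewrite -combB cd subrr.
have comb_cont : continuous comb.
  exact: (@lin_comb_continuous _ _ _ e).
have [M M0 combM] : exists2 M : R, 0 < M & forall c, `|c| <= M * `|comb c|.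
  pose S := [set c : 'rV[R]_n | `|c| = 1].
  have ncont : continuous (fun c => `|comb c| : R).
    by move=> c; apply: continuous_comp; [exact: comb_cont|exact: norm_continuous].
  have unitS c : c != 0 -> S (`|c|^-1 *: c).
    by move=> c0; rewrite /S /= normrZ normfV normr_id mulVf ?normr_eq0.
  (* An empty sphere means that 0 is the only coordinate vector; then any constant works. *)
  have [S0|Sn] := pselect (S !=set0); last first.
    exists 1 => // c; have [->|/unitS Sc] := eqVneq c 0; first by rewrite normr0 mul1r.
    by exfalso; apply: Sn; exists (`|c|^-1 *: c).
  have cS : compact S.
    apply: bounded_closed_compact.
      exists 1; split=> // x x1 c Sc; apply: le_trans (ltW x1).
      by rewrite le_eqVlt Sc eqxx.
    rewrite (_ : S = Num.Def.normr @^-1` [set 1]) //.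
    by apply: closed_comp => [c _|]; [exact: norm_continuous|exact: closed_eq].
  have [c1 /set_mem Sc1 c1min] := compact_EVT_min S0 cS (continuous_subspaceT ncont).
  have c1_gt0 : 0 < `|comb c1|.
    rewrite normr_gt0; apply/eqP => /comb0 c10; move: Sc1.
    by rewrite /S /= c10 normr0 => /esym/eqP; rewrite oner_eq0.
  exists `|comb c1|^-1; first by rewrite invr_gt0.
  move=> c; rewrite ler_pdivlMl //.
  have [->|c0] := eqVneq c 0; first by rewrite normr0 mulr0.
  have := c1min _ (mem_set (unitS c c0)).
  by rewrite combZ normrZ normfV normr_id ler_pdivlMl ?normr_gt0 // mulrC.
have combK v : comb (k v) = v by rewrite [RHS]kE.
exists n, e, k, M; split=> [|t u v|//|v]; first exact: ltW.
  by apply: combI; rewrite combD combZ !combK.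
by rewrite -{2}(combK v); exact: combM.
Qed.

Section FiniteDimension.
Context {R : realType} {V : normedModType R}.
Hypothesis hV : finite_dimensional V.

Lemma finite_dim_bounded_op (W : normedModType R) (f : V -> W) :
  linear f -> f \in bounded_op.
Proof.
have [n [e [k [M [M0 kl kE kM]]]]] := finite_dim_coord hV; move=> fl.
apply/bounded_opP; split=> //; exists ((\sum_i `|f (e i)|) * M) => v.
have f0 : f 0 = 0 by have := fl (-1) 0 0; rewrite !scaleN1r !addNr.
have -> : f v = \sum_i k v 0 i *: f (e i).
  rewrite {1}(kE v); elim/big_ind2 : _ => // [u x w y <- <-|i _].
    by have := fl 1 x y; rewrite !scale1r.
  by have := fl (k v 0 i) (e i) 0; rewrite !addr0 f0 addr0.
rewrite (le_trans (ler_norm_sum _ _ _)) // -mulrA mulr_suml.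
apply: ler_sum => i _; rewrite normrZ mulrC ler_wpM2l //.
exact: le_trans (coord_norm_le _ _) (kM v).
Qed.

(** The ball is the continuous image of a closed set [K] of coordinate vectors, which is bounded
    because the coordinate map is. *)
Lemma finite_dim_compact_unit_ball : compact (unit_ball V).
Proof.
have [n [e [k [M [M0 kl kE kM]]]]] := finite_dim_coord hV.
pose comb (c : 'rV[R]_n) := \sum_i c 0 i *: e i.
have comb_cont : continuous comb.
  exact: (@lin_comb_continuous _ _ _ e).
have ball_closed : closed [set c : 'rV[R]_n | `|comb c| <= 1].
  apply: (@closed_comp _ _ (fun c => `|comb c|) [set x | x <= 1]) => [c _|].
    by apply: continuous_comp; [exact: comb_cont|exact: norm_continuous].
  exact: closed_le.
pose K := [set c : 'rV[R]_n | `|c| <= M] `&` [set c | `|comb c| <= 1].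
have cK : compact K.
  apply: bounded_closed_compact.
    exists M; split=> [|x Mx c [/= cM _]]; first exact: num_real.
    exact: le_trans cM (ltW Mx).
  apply: closedI => //.
  apply: (@closed_comp _ _ (fun c : 'rV[R]_n => `|c|) [set x : R | x <= M]) => [c _|].
    exact: norm_continuous.
  exact: closed_le.
have -> : unit_ball V = comb @` K.
  apply/seteqP; split=> [v v1|_ [c [_ c1] <-] //].
  exists (k v) => //.
  split; rewrite /= /comb -?kE // (le_trans (kM v)) // ler_piMr //.
apply: continuous_compact => //; exact: continuous_subspaceT.
Qed.

End FiniteDimension.

Lemma lin_indep_dual_family (R : realType) (V : normedModType R) r
    (x : 'I_r -> V) :
  finite_dimensional V -> lin_indep x ->
  exists2 xi : 'I_r -> V -> R, (forall i, linear (xi i : V -> R^o)) &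
    forall i j, xi i (x j) = (i == j)%:R.
Proof.
move=> hV hx; have [n [e [k [M [_ kl kE _]]]]] := finite_dim_coord hV.
pose A := \matrix_(i, j) k (x i) 0 j.
have rfA : row_free A by apply: (row_free_lin_indep hx) => i; exact: kE.
(* The rows of [A] are the coordinates of the [x j]; as [A] is row free, [pinvmx A] is a right
   inverse and sends row [j] to the [j]-th unit vector. *)
exists (fun i v => (k v *m pinvmx A) 0 i) => [i t u v|i j].
  by rewrite kl mulmxDl -scalemxAl !mxE.
have -> : k (x j) = row j A by apply/rowP => a; rewrite !mxE.
by rewrite -row_mul mulmxVp // !mxE eq_sym.
Qed.

(* A maximiser over [F] of a strictly convex function is an extreme point;
   here the function is the sum of the squares of the coordinates. *)
Lemma compact_face_extreme (R : realType) (V : normedModType R) (F : set V) :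
  finite_dimensional V -> F !=set0 -> compact F -> F `<=` unit_ball V ->
  (forall y z (t : R), unit_ball V y -> unit_ball V z -> 0 < t -> t < 1 ->
     F (t *: y + (1 - t) *: z) -> F y /\ F z) ->
  exists2 v, F v & extreme_points (unit_ball V) v.
Proof.
move=> hV F0 cF FB Fface; have [n [e [k [M [_ kl kE kM]]]]] := finite_dim_coord hV.
pose q v : R := \sum_i k v 0 i ^+ 2.
have k_cont i : continuous (fun v => k v 0 i : R^o).
  apply: (@lipschitz_continuous _ _ _ _ M) => u v.
  have -> : k u 0 i - k v 0 i = k (u - v) 0 i.
    by have := kl (-1) v u; rewrite !scaleN1r [- v + _]addrC => ->; rewrite !mxE addrC.
  exact: le_trans (coord_norm_le _ _) (kM _).
have q_cont : continuous q.
  apply: continuous_big => [|i _]; first exact: add_continuous.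
  by move=> v; under eq_fun do rewrite expr2; apply: cvgM; exact: k_cont.
have [v /set_mem Fv vmax] := compact_EVT_max F0 cF (continuous_subspaceT q_cont).
exists v => //; split; first exact: FB.
move=> y z t By Bz t0 t1 vE.
have [Fy Fz] : F y /\ F z by apply: (Fface y z t) => //; rewrite -vE.
(* This identity makes strict convexity quantitative: as [q v] is maximal on [F], the last term must
   vanish. *)
have qE : q v = t * q y + (1 - t) * q z - t * (1 - t) * q (y - z).
  rewrite /q !mulr_sumr -big_split -sumrB /=; apply: eq_bigr => i _.
  have k0 : k 0 = 0 by have := kl (-1) 0 0; rewrite !scaleN1r !addNr.
  have -> : k v = t *: k y + (1 - t) *: k z.
    by have := kl t y ((1 - t) *: z); rewrite -vE => ->;
      have := kl (1 - t) z 0; rewrite k0 !addr0 => ->.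
  have -> : k (y - z) = k y - k z.
    by have := kl (-1) z y; rewrite !scaleN1r [- z + y]addrC => ->; rewrite addrC.
  by rewrite !mxE; ring.
have qyz0 : q (y - z) = 0.
  apply/le_anti/andP; split; last by apply: sumr_ge0 => i _; exact: sqr_ge0.
  have tt : 0 < t * (1 - t) by rewrite mulr_gt0 // subr_gt0.
  rewrite -(pmulr_rle0 _ tt).
  have t1' : 0 < 1 - t by rewrite subr_gt0.
  have qy : t * q y <= t * q v by rewrite ler_pM2l // vmax // mem_set.
  have qz : (1 - t) * q z <= (1 - t) * q v by rewrite ler_pM2l // vmax // mem_set.
  by lra.
have yz : y = z.
  apply/eqP; rewrite -subr_eq0; apply/eqP; rewrite [LHS]kE big1 // => i _.
  move/eqP: qyz0; rewrite psumr_eq0; last by move=> j _; exact: sqr_ge0.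
  by move=> /allP/(_ i (mem_index_enum _)); rewrite /= sqrf_eq0 => /eqP ->;
    rewrite scale0r.
by rewrite vE -yz -scalerDl addrC subrK scale1r.
Qed.

(** * Support functionals of operators *)

Lemma blop_continuous (R : realType) (V W : normedModType R) (T : blop V W) :
  continuous T.
Proof.
by apply: (@lipschitz_continuous _ _ _ _ `|T|) => u v; rewrite -linearB blop_le.
Qed.

Lemma blop_norm_continuous (R : realType) (V W : normedModType R) (T : blop V W) :
  continuous (fun v => `|T v|).
Proof.
move=> v; apply: continuous_comp; first exact: blop_continuous.
exact: norm_continuous.
Qed.

Lemma convex_comb_max (R : realType) (a b c t : R) :
  0 < t -> t < 1 -> a <= c -> b <= c -> c <= t * a + (1 - t) * b ->
  a = c /\ b = c.
Proof.
move=> t0 t1 ac bc cab; have t1' : 0 < 1 - t by rewrite subr_gt0.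
have bc' : (1 - t) * b <= (1 - t) * c by rewrite ler_pM2l.
have ac' : t * a <= t * c by rewrite ler_pM2l.
by split; apply/le_anti; rewrite ?ac ?bc /=;
  [rewrite -(ler_pM2l t0)|rewrite -(ler_pM2l t1')]; lra.
Qed.

Lemma norm_convex_comb (R : realType) (V W : normedModType R) (T : blop V W)
    (y z : V) (t : R) : 0 < t -> t < 1 ->
  `|T (t *: y + (1 - t) *: z)| <= t * `|T y| + (1 - t) * `|T z|.
Proof.
move=> t0 t1; rewrite linearD !linearZ (le_trans (ler_normD _ _)) //=.
by rewrite !normrZ !gtr0_norm // subr_gt0.
Qed.

Section SupportFunctionals.
Context {R : realType} {X Y : normedModType R}.
Hypothesis hX : finite_dimensional X.
Variable T : blop X Y.
Hypothesis hT : `|T| = 1.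

Lemma blop_norm_attained (S : blop X Y) :
  exists2 v, unit_ball X v & `|S v| = `|S|.
Proof.
have ball0 : unit_ball X !=set0 by exists 0; rewrite /unit_ball /= normr0.
have [v /set_mem Bv vmax] := compact_EVT_max ball0 (finite_dim_compact_unit_ball hX)
  (continuous_subspaceT (@blop_norm_continuous _ _ _ S)).
exists v => //; apply/le_anti; rewrite op_norm_ub //=.
by apply: op_norm_lub => u u1; exact/vmax/mem_set.
Qed.

(* First-order perturbation: [1 + t f(S) <= |T + t S|] forces the maximisers of
   [T + t S] to satisfy [f S <= |S v|], and they accumulate at maximisers of
   [T] as [t] tends to [0]. *)
Lemma support_functional_le_attained (f : dual (blop X Y)) (S : blop X Y) :
  support_functionals T f ->
  exists v, [/\ unit_ball X v, `|T v| = 1 & f S <= `|S v|].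
Proof.
move=> [f1 fT].
(* For a maximiser [v] of [T + t S], [1 + t f(S) <= |T v| + t |S v|]. Bounding [f(S)] below and
   [|S v|] above costs at most [t * K]. *)
pose K := `|f S| + `|S|; have K0 : 0 <= K by rewrite addr_ge0.
pose C := unit_ball X `&` [set v | f S <= `|S v|].
have approx t : 0 < t -> exists2 v, C v & 1 - t * K <= `|T v|.
  move=> t0; have [v Bv vE] := blop_norm_attained (T + t *: S).
  have fle : 1 + t * f S <= `|T v| + t * `|S v|.
    have -> : 1 + t * f S = f (T + t *: S).
      by rewrite [T + _]addrC (blop_linear f) fT [RHS]addrC.
    rewrite (le_trans (ler_norm _)) // (le_trans (blop_le _ _)) // f1 mul1r -vE.
    by rewrite blopD blopZ (le_trans (ler_normD _ _)) // normrZ gtr0_norm.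
  have Tv : `|T v| <= 1 by rewrite -hT op_norm_ub.
  exists v; first by split=> //=; rewrite -(ler_pM2l t0); lra.
  have Sv : t * `|S v| <= t * `|S| by rewrite ler_pM2l // op_norm_ub.
  have fS : t * - `|f S| <= t * f S by rewrite ler_pM2l // lerNl -normrN ler_norm.
  by rewrite /K mulrDr; lra.
have cC : compact C.
  apply: compact_closedI; first exact: finite_dim_compact_unit_ball.
  apply: (@closed_comp _ _ (fun v => `|S v|) [set s : R | f S <= s]) => [v _|].
    exact: blop_norm_continuous.
  exact: closed_ge.
have C0 : C !=set0 by have [v Cv _] := approx 1 ltr01; exists v.
(* No limit point is extracted: a maximiser of [|T v|] over the compact set [C] has value at least
   [1 - t * K] for every [t > 0], hence value 1. *)
have [v /set_mem [Bv Sv] vmax] :=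
  compact_EVT_max C0 cC (continuous_subspaceT (@blop_norm_continuous _ _ _ T)).
exists v; split=> //; apply/le_anti; rewrite -{1}hT op_norm_ub //=.
apply/ler_addgt0Pl => e e0.
(* With [t = e / (K + 1)] the loss [t * K] is at most [e], and [K = 0] causes no division by
   zero. *)
have t0 : 0 < e / (K + 1) by rewrite divr_gt0 // ltr_wpDl.
have [u Cu] := approx _ t0; have := vmax _ (mem_set Cu).
have : e / (K + 1) * K <= e.
  by rewrite mulrAC ler_pdivrMr ?ltr_wpDl // ler_wpM2l ?(ltW e0) // lerDl.
by lra.
Qed.

Lemma support_functional_le_extreme (f : dual (blop X Y)) (S : blop X Y) :
  support_functionals T f ->
  exists2 v, (norm_attainment T `&` extreme_points (unit_ball X)) v &
    f S <= `|S v|.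
Proof.
move=> fT; have [u [Bu Tu fSu]] := support_functional_le_attained S fT.
pose M := unit_ball X `&` [set v | `|T v| = 1].
have cM : compact M.
  apply: compact_closedI; first exact: finite_dim_compact_unit_ball.
  apply: (@closed_comp _ _ (fun v => `|T v|) [set s : R | s = 1]) => [v _|].
    exact: blop_norm_continuous.
  exact: closed_eq.
have M0 : M !=set0 by exists u.
have [w /set_mem [Bw Tw] wmax] :=
  compact_EVT_max M0 cM (continuous_subspaceT (@blop_norm_continuous _ _ _ S)).
have fSw : f S <= `|S w| by apply: (le_trans fSu); apply/wmax/mem_set.
pose F := M `&` [set v | `|S v| = `|S w|].
have [||||v [[Bv Tv] Sv] vext] := @compact_face_extreme _ _ F hX.
- by exists w.
- apply: compact_closedI => //.
  apply: (@closed_comp _ _ (fun v => `|S v|) [set s : R | s = `|S w|]) => [v _|].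
    exact: blop_norm_continuous.
  exact: closed_eq.
- by move=> v [[]].
- move=> y z t By Bz t0 t1 [[_ Tyz] Syz].
  have [Ty Tz] : `|T y| = 1 /\ `|T z| = 1.
    apply: (convex_comb_max t0 t1);
      [by rewrite -hT op_norm_ub|by rewrite -hT op_norm_ub|].
    by rewrite -[leLHS]Tyz norm_convex_comb.
  (* The maximum of [|S v|] is taken over [M] only, so this needs that [y] and [z] lie in [M], which
     the previous step gives. *)
  have [Sy Sz] : `|S y| = `|S w| /\ `|S z| = `|S w|.
    apply: (convex_comb_max t0 t1); [exact/wmax/mem_set|exact/wmax/mem_set|].
    by rewrite -[leLHS]Syz norm_convex_comb.
  by [].
exists v; last by rewrite Sv.
split=> //; split; last by rewrite Tv hT.
apply/le_anti; rewrite Bv /=.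
by have := blop_le T v; rewrite Tv hT mul1r.
Qed.

End SupportFunctionals.

Lemma lin_span_linear (R : realType) (U V : lmodType R) (h : {linear U -> V})
    (A : set U) (B : set V) :
  (forall u, A u -> lin_span B (h u)) ->
  forall u, lin_span A u -> lin_span B (h u).
Proof.
move=> hAB _ [n [c [a [Aa ->]]]]; rewrite linear_sum; apply: lin_span_sum => i.
by rewrite linearZ; exact/lin_spanZ/hAB.
Qed.

Section EvalDual.
Context {R : realType} {X Y : normedModType R}.

Lemma eval_dual_bounded (v : X) (g : dual Y) :
  (fun S : blop X Y => g (S v)) \in @bounded_op R (blop X Y) R^o.
Proof.
apply/bounded_opP; split=> [t S S'|].
  by rewrite blopD blopZ (blop_linear g).
exists (`|g| * `|v|) => S; rewrite (le_trans (blop_le _ _)) // -mulrA.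
by rewrite ler_wpM2l // mulrC blop_le.
Qed.

(** This is the elementary tensor of [v] and [g], acting on operators. *)
Definition eval_dual (v : X) (g : dual Y) : dual (blop X Y) :=
  Blop (eval_dual_bounded v g).

Lemma eval_dual_linear v : linear (eval_dual v).
Proof. by move=> t g g'; apply: val_inj. Qed.

HB.instance Definition _ v := GRing.isLinear.Build R (dual Y) (dual (blop X Y)) _
  (eval_dual v) (eval_dual_linear v).

End EvalDual.

Lemma blop_sumE (R : realType) (V W : normedModType R) (I : finType)
    (f : I -> blop V W) v : (\sum_i f i) v = \sum_i f i v.
Proof. by elim/big_rec2 : _ => // i _ y _ <-. Qed.

(** * The span of J(T) as a direct sum *)

Section SpanSupport.
Context {R : realType} {X Y : normedModType R}.
Hypothesis hX : finite_dimensional X.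
Variable T : blop X Y.
Hypothesis hT : `|T| = 1.
Variables (r : nat) (x : 'I_r -> X).
Hypothesis hMT : norm_attainment T `&` extreme_points (unit_ball X) =
  [set x i | i in [set: 'I_r]] `|` [set - x i | i in [set: 'I_r]].
Variable xi : 'I_r -> X -> R.
Hypothesis xi_linear : forall i, linear (xi i : X -> R^o).
Hypothesis xi_dual : forall i j, xi i (x j) = (i == j)%:R.

Lemma norm_attainment_basis i : `|x i| = 1 /\ `|T (x i)| = 1.
Proof.
have [[x1 Tx] _] : (norm_attainment T `&` extreme_points (unit_ball X)) (x i).
  by rewrite hMT; left; exists i.
by split; [exact: x1|rewrite -hT; exact: Tx].
Qed.

Lemma support_functional_le (f : dual (blop X Y)) (S : blop X Y) :
  support_functionals T f -> exists i, f S <= `|S (x i)|.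
Proof.
move=> /(support_functional_le_extreme hX hT S)[v]; rewrite hMT.
by move=> [] [i _ <-] fS; exists i; rewrite // -normrN -linearN.
Qed.

Lemma rank_one_bounded i z :
  (fun v => xi i v *: z) \in @bounded_op R X Y.
Proof.
apply: (finite_dim_bounded_op hX) => t u v.
by rewrite (xi_linear i) scalerDl scalerA.
Qed.

(** Adding this operator changes the value at [x i] by [z] and leaves the values at the other [x j]
    alone. *)
Definition rank_one i z : blop X Y := Blop (rank_one_bounded i z).

Lemma rank_oneE i z j : rank_one i z (x j) = if i == j then z else 0.
Proof.
rewrite -[LHS]/(xi i (x j) *: z) xi_dual.
by case: eqP => _; rewrite ?scale1r ?scale0r.
Qed.

Lemma rank_one_linear i : linear (rank_one i).
Proof.
move=> t z w; apply: val_inj; apply/funext => v.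
rewrite -[LHS]/(xi i v *: (t *: z + w)) -[RHS]/(t *: (xi i v *: z) + xi i v *: w).
by rewrite scalerDr !scalerA [_ * t]mulrC.
Qed.

Lemma coeff_bounded (f : dual (blop X Y)) i :
  (fun z => f (rank_one i z)) \in @bounded_op R Y R^o.
Proof.
apply/bounded_opP; split=> [t z w|].
  by rewrite (rank_one_linear i) (blop_linear f).
have /(finite_dim_bounded_op hX)/bounded_opP[_ [M xiM]] := xi_linear i.
exists (`|f| * `|M|) => z; rewrite (le_trans (blop_le _ _)) // -mulrA.
rewrite ler_wpM2l //; apply: blop_norm_le => [|v]; first exact: mulr_ge0.
rewrite -[X in `|X|]/(xi i v *: z) normrZ mulrAC ler_wpM2r //.
by rewrite (le_trans (xiM v)) // ler_wpM2r // ler_norm.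
Qed.

(** If [f] is a sum of functionals [eval_dual (x j) (g j)], testing it on [rank_one i z] returns
    [g i z]; so this is the only candidate for the [i]-th component. *)
Definition coeff (f : dual (blop X Y)) i : dual Y := Blop (coeff_bounded f i).

(** Replace [S] by the operator [S'] built from rank-one operators with the same values at the
    [x j]. Both [S - S'] and [S' - S] vanish at every [x j], so [f] is at most 0 on each, and
    [f S = f S']. *)
Lemma support_functional_decomp (f : dual (blop X Y)) :
  support_functionals T f -> f = \sum_i eval_dual (x i) (coeff f i).
Proof.
move=> fT; apply: val_inj; apply/funext => S /=; rewrite blop_sumE.
pose S' := \sum_i rank_one i (S (x i)).
have S'E j : S' (x j) = S (x j).
  rewrite /S' blop_sumE (bigD1 j) // rank_oneE eqxx.
  rewrite big1 => [|i /andP[_ ij]]; first exact: addr0.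
  by rewrite rank_oneE (negbTE ij).
have -> : \sum_i eval_dual (x i) (coeff f i) S = f S'.
  by rewrite linear_sum.
have fle0 (D : blop X Y) : (forall j, D (x j) = 0) -> f D <= 0.
  by move=> D0; have [j] := support_functional_le D fT; rewrite D0 normr0.
apply/le_anti/andP; split; rewrite -subr_le0 -linearB; apply: fle0 => j.
  by rewrite -[LHS]/(S (x j) - S' (x j)) S'E subrr.
by rewrite -[LHS]/(S' (x j) - S (x j)) S'E subrr.
Qed.

(* The operator that maps [x i] to [w] and agrees with [T] on the other [x j]
   has norm at most 1 on every [x j]; hence [coeff f i] attains its norm at
   [T (x i)]. *)
Lemma coeff_support (f : dual (blop X Y)) i :
  support_functionals T f ->
  lin_span (support_functionals (T (x i))) (coeff f i).
Proof.
move=> fT; set g := coeff f i; set a := g (T (x i)).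
have gle w : `|w| <= 1 -> g w <= a.
  move=> w1; rewrite -subr_le0 -linearB.
  have [j] := support_functional_le (T + rank_one i (w - T (x i))) fT.
  have -> : f (T + rank_one i (w - T (x i))) = 1 + g (w - T (x i)).
    by have [_ <-] := fT; exact: (linearD f).
  have [_ Txj] := norm_attainment_basis j; rewrite blopD rank_oneE.
  case: eqP => [<-|_]; first by rewrite [T _ + _]addrC subrK => gw; lra.
  by rewrite addr0 Txj => ?; lra.
have a0 : 0 <= a by rewrite -(linear0 g) gle ?normr0.
have ga : `|g| <= a.
  apply: op_norm_lub => w w1; rewrite ler_norml lerNl -linearN.
  by rewrite !gle ?normrN.
(* A zero [g] cannot be normalised but lies in every span; otherwise [a^-1 *: g] is a support
   functional at [T (x i)]. *)
have [a_eq0|a_neq0] := eqVneq a 0.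
  have -> : g = 0 by apply/eqP; rewrite -normr_le0 -a_eq0.
  exact: lin_span0.
have [_ Txi] := norm_attainment_basis i.
have gE : `|g| = a.
  apply/le_anti; rewrite ga /= (le_trans (ler_norm a)) //.
  by rewrite (le_trans (blop_le g _)) // Txi mulr1.
rewrite -[g](scalerKV a_neq0); apply/lin_spanZ/sub_lin_span; split.
  by rewrite /unit_sphere /= normrZ normfV gE ger0_norm // mulVf.
by rewrite blopZ; exact: mulVf.
Qed.

(** One inclusion regroups the decompositions of the support functionals by [i]. For the other,
    [x i] has norm 1, so [eval_dual (x i)] maps J(T x_i) into J(T). *)
Lemma span_support_functionals :
  lin_span (support_functionals T) =
  [set f | exists g : 'I_r -> dual Y,
     (forall i, lin_span (support_functionals (T (x i))) (g i)) /\
     f = \sum_i eval_dual (x i) (g i)].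
Proof.
apply/seteqP; split=> [_ [n [c [f [fT ->]]]]|_ [g [gT ->]]].
  exists (fun i => \sum_j c j *: coeff (f j) i); split=> [i|].
    by apply: lin_span_sum => j; exact/lin_spanZ/coeff_support.
  under [RHS]eq_bigr do rewrite linear_sum.
  rewrite exchange_big /=; apply: eq_bigr => j _.
  rewrite {1}(support_functional_decomp (fT j)) scaler_sumr.
  by apply: eq_bigr => i _; rewrite linearZ.
apply: lin_span_sum => i.
apply: (lin_span_linear _ (gT i)) => h [h1 hTx]; apply: sub_lin_span; split=> //.
apply/le_anti/andP; split.
  apply: blop_norm_le => // S; rewrite mul1r.
  have [x1 _] := norm_attainment_basis i.
  rewrite (le_trans (blop_le h _)) // h1 mul1r (le_trans (blop_le _ _)) //.
  by rewrite x1 mulr1.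
have := blop_le (eval_dual (x i) h) T; rewrite hT mulr1.
by rewrite -[X in `|X|]/(h (T (x i))) hTx normr1.
Qed.

(** Testing the sum on [rank_one i z] leaves only [g i z]. *)
Lemma eval_dual_direct (g : 'I_r -> dual Y) :
  \sum_i eval_dual (x i) (g i) = 0 -> forall i, g i = 0.
Proof.
move=> g0 i; apply: val_inj; apply/funext => z; rewrite -[RHS]/(0 : R^o).
have <- : (\sum_j eval_dual (x j) (g j)) (rank_one i z) = 0 by rewrite g0.
rewrite blop_sumE (bigD1 i) //= [X in _ = X + _](_ : _ = g i z); last first.
  by rewrite -[LHS]/(g i (rank_one i z (x i))) rank_oneE eqxx.
rewrite big1 ?addr0 // => j ji.
by rewrite -[LHS]/(g j (rank_one i z (x j))) rank_oneE eq_sym (negbTE ji) linear0.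
Qed.

Lemma eval_dual_inj i : injective (eval_dual (x i) : dual Y -> dual (blop X Y)).
Proof.
move=> g h gh; apply: val_inj; apply/funext => z.
have : eval_dual (x i) g (rank_one i z) = eval_dual (x i) h (rank_one i z).
  by rewrite gh.
rewrite -[LHS]/(g (rank_one i z (x i))) -[RHS]/(h (rank_one i z (x i))).
by rewrite rank_oneE eqxx.
Qed.

End SpanSupport.

(** For [k = 0] the span would be zero, but it contains a functional with value 1 at [v]. *)
Lemma k_smooth_gt0 (R : realType) (V : normedModType R) k (v : V) :
  k_smooth k v -> (0 < k)%N.
Proof.
move=> [v1 [e [_ eS]]]; rewrite lt0n; apply/eqP => k0.
have [f fv] := support_functionals_nonempty v1.
have /lin_span_rangeP[c fE] : lin_span (range e) f.
  by rewrite eS; exact: sub_lin_span.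
have f0 : f = 0 by rewrite fE big1 // => -[j jk]; exfalso; rewrite k0 in jk.
have [_] := fv; rewrite f0 -[LHS]/(0 : R) => /esym/eqP.
by rewrite oner_eq0.
Qed.

Theorem theorem2p2 (R : realType) (X Y : completeNormedModType R)
    (hX : finite_dimensional X) (T : blop X Y) (hT : `|T| = 1)
    (r : nat) (x : 'I_r -> X) (hx : lin_indep x)
    (hMT : norm_attainment T `&` extreme_points (unit_ball X) =
           [set x i | i in [set: 'I_r]] `|` [set - x i | i in [set: 'I_r]])
    (k : nat) (hk : (0 < k)%N) :
  k_smooth k T <->
  exists m : 'I_r -> nat,
    (forall i, (0 < m i)%N /\ k_smooth (m i) (T (x i))) /\
    (\sum_(i < r) m i)%N = k.
Proof.
have [xi xi_lin xi_dual] := lin_indep_dual_family hX hx.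
have spanE := span_support_functionals hX hT hMT xi_lin xi_dual.
have dirT := eval_dual_direct (Y := Y) hX xi_lin xi_dual.
have dimT m : (forall i, has_dim (lin_span (support_functionals (T (x i)))) (m i)) ->
    has_dim (lin_span (support_functionals T)) (\sum_i m i).
  move=> mT; rewrite spanE.
  exact: (@has_dim_direct_sum _ (dual Y) (dual (blop X Y)) _ (fun i => eval_dual (x i))
    _ _ dirT mT).
split=> [[_ Tk]|[m [mT <-]]]; last by split=> //; apply: dimT => i; have [_ []] := mT i.
(* The dimensions [m i] are not given in this direction: they exist because [eval_dual (x i)] embeds
   span J(T x_i) into the finite-dimensional span J(T). *)
have /choice[m mT] i : exists m, has_dim (lin_span (support_functionals (T (x i)))) m.
  have inj_i := eval_dual_inj (Y := Y) hX xi_lin xi_dual (i := i).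
  apply: (has_dim_preim inj_i _ Tk) => g gT; rewrite spanE.
  exists (fun j => if j == i then g else 0); split=> [j|].
    by case: eqP => [->//|_]; exact: lin_span0.
  rewrite (bigD1 i) //= eqxx big1 ?addr0 // => j /negbTE ->.
  exact: linear0.
have mk i : k_smooth (m i) (T (x i)).
  by split=> //; have [] := norm_attainment_basis hT hMT i.
exists m; split=> [i|]; first by split=> //; exact: k_smooth_gt0 (mk i).
exact: has_dim_uniq (dimT _ mT) Tk.
Qed.
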